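(* Let $V$ be a finite set with $n$ elements, let $C \ge 2$ be a constant, and let $\mathsf{ALG}$ be any (possibly randomized) parallel algorithm for submodular function minimization (SFM) on the ground set $V$ that makes at most $Q := n^C$ evaluation oracle queries per round. Then there exists a submodular function $F: 2^V \to \mathbb{R}$ such that, with high probability, $\mathsf{ALG}$ takes at least $\frac{n}{2C\log_2 n}$ rounds to minimize $F$; that is, with high probability over the internal randomness of $\mathsf{ALG}$, $\mathsf{ALG}$ does not output a minimizer of $F$ after fewer than $\frac{n}{2C\log_2 n}$ rounds of queries.
   Context: A function $f: 2^V \to \mathbb{R}$ on subsets of a finite set $V$ is submodular if $f(X)+f(Y) \ge f(X\cup Y) + f(X \cap Y)$ for all $X, Y \subseteq V$. SFM problem: given black-box access to a submodular $f:2^V\to\mathbb{R}$ through an evaluation oracle, which returns the value $f(S)$ when queried with a set $S\subseteq V$, find a set $S \subseteq V$ minimizing $f$. A parallel SFM algorithm proceeds in rounds: in each round it submits a collection of query sets simultaneously (here at most $n^C$ of them), which may depend on the answers received in all previous rounds and on the algorithm's internal randomness, and receives all their values; after some number of rounds it outputs a set. Computation between rounds is unrestricted. ''With high probability'' means with probability $1-o(1)$ as $n\to\infty$ with $C$ fixed, where the $o(1)$ term depends only on $n$ and $C$. *)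

(* Defs.v *)
From HB Require Import structures.
From mathcomp Require Import all_boot all_order all_algebra.
From mathcomp Require Import all_classical all_reals all_analysis.
Import Order.TTheory GRing.Theory Num.Theory.
Import numFieldNormedType.Exports.

Set Implicit Arguments.
Unset Strict Implicit.
Unset Printing Implicit Defensive.

Local Open Scope classical_set_scope.
Local Open Scope ring_scope.

Definition submodular (R : realType) (V : finType) (f : {set V} -> R) : Prop :=
  forall X Y : {set V}, f X + f Y >= f (X :|: Y) + f (X :&: Y).

Definition minimizer (R : realType) (V : finType) (f : {set V} -> R)
    (S : {set V}) : Prop :=
  forall X : {set V}, f S <= f X.

Definition log2 (R : realType) (x : R) : R := ln x / ln 2.

(* Between two rounds an algorithm either submits one more batch of queries
   or stops with an output set.  Repeated queries in a batch are counted with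
   multiplicity. *)
Inductive action (V : finType) : Type :=
  | Query of seq {set V}
  | Output of {set V}.

(* One entry per completed round, in chronological order; each entry lists the
   queries of that round together with the oracle's answers. *)
Definition history (R : realType) (V : finType) : Type :=
  seq (seq ({set V} * R)).

(* An algorithm whose internal randomness has been fixed.  It is an arbitrary
   function of the answers received so far, and sees the oracle only through
   them. *)
Definition algorithm (R : realType) (V : finType) : Type :=
  history R V -> action V.

Definition answers (R : realType) (V : finType) (f : {set V} -> R)
    (q : seq {set V}) : seq ({set V} * R) :=
  [seq (X, f X) | X <- q].

(* The history after k rounds with oracle f, or the final history if the
   algorithm stops earlier. *)
Fixpoint transcript (R : realType) (V : finType) (a : algorithm R V)
    (f : {set V} -> R) (k : nat) : history R V :=
  if k is k'.+1 then
    let h := transcript a f k' in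
    match a h with
    | Query q => rcons h (answers f q)
    | Output _ => h
    end
  else [::].

(* Some X if the algorithm has stopped with output X after at most k rounds of
   queries, None if it is still running. *)
Definition output_within (R : realType) (V : finType) (a : algorithm R V)
    (f : {set V} -> R) (k : nat) : option {set V} :=
  if a (transcript a f k) is Output X then Some X else None.

(* The bound is only required along executions against submodular oracles. *)
Definition queries_per_round_le (R : realType) (V : finType)
    (a : algorithm R V) (Q : R) : Prop :=
  forall f : {set V} -> R, submodular f ->
  forall (k : nat) (q : seq {set V}),
    a (transcript a f k) = Query q -> (size q)%:R <= Q.

Definition minimizes_in_fewer_than (R : realType) (V : finType)
    (a : algorithm R V) (f : {set V} -> R) (r : R) : Prop :=
  exists (k : nat) (S : {set V}),
    [/\ k%:R < r, output_within a f k = Some S & minimizer f S].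

(* The internal randomness is a point of an arbitrary probability space T; at
   every history the next action is a random variable, the countable type of
   actions carrying the discrete sigma-algebra. *)
Definition randomized (d : measure_display) (T : measurableType d)
    (R : realType) (V : finType) (A : T -> algorithm R V) : Prop :=
  forall (h : history R V) (B : set (action V)),
    measurable [set w | B (A w h)].

(* Main.v *)
(* Fix disjoint blocks B_0, ..., B_(m-1) of size b of the ground set, and hide a
   uniformly random set A.  The hard function first charges S for the distance
   between S and A on B_0; only when S and A agree on B_0 does it let through a
   scaled-down copy of the hard function of the remaining blocks.  A query thus
   reveals A on B_0, ..., B_j at most, where B_j is the first block on which the
   query disagrees with A.  After j rounds in which nothing beyond the first j
   blocks was revealed, each query of the next round guesses A on B_j with
   probability 2^-b, and an output that minimizes the function must agree with A
   on every block.  Taking m just above n / (2 C log2 n) makes 2^b at least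
   n^(2C) / 4, so a union bound over m rounds of n^C queries gives a failure
   probability of at most 4 / n; averaging over A fixes one function for which a
   randomized algorithm fails. *)
Require Import Defs.
From HB Require Import structures.
From mathcomp Require Import all_boot all_order all_algebra.
From mathcomp Require Import all_classical all_reals all_analysis.
From mathcomp Require Import zify ring lra measurable_realfun.
Import Order.TTheory GRing.Theory Num.Theory.
Import numFieldNormedType.Exports.

Local Open Scope ring_scope.

(** * Submodularity and minimizers of the nested hard functions *)

Section HardFunction.
Context {R : realType} {V : finType}.
Implicit Types (B A S X Y : {set V}) (l : seq {set V}).

(* The size of the symmetric difference of S and A inside B, in the form of a sum
   of modular functions of S. *)
Definition dist_on B A S : R :=
  #|S :&: B|%:R + #|A :&: B|%:R - 2 * #|S :&: B :&: A|%:R.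

Definition excess_on B A S : R := #|S :&: B|%:R - #|A :&: B|%:R.

(* The first term makes A the only optimum on B.  The other two are functions of
   cardinalities, independent of A outside B, that make the submodular
   inequality strict by at least 4 for incomparable sets with distinct traces on
   B; this pays for any perturbation of absolute value at most 1. *)
Definition block_fun B A S : R :=
  (6 * #|V|%:R + 3) * dist_on B A S - 2 * excess_on B A S ^+ 2
  - 4 * excess_on B A S * #|S :\: B|%:R.

(** With [n = #|V|], the three terms of [block_fun] are at most [6 * n ^ 2 + 3 * n], [2 * n ^ 2] and
    [4 * n ^ 2] in absolute value; the final 1 leaves room for the perturbation. *)
Definition hard_bound : R := 12 * #|V|%:R ^+ 2 + 3 * #|V|%:R + 1.

(* Dividing by hard_bound keeps the perturbation within [-1, 1]. The constant does
   not depend on the number of blocks, so that truncating the list of blocks does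
   not change the values seen by sets that miss A early. *)
Fixpoint hard_fun l A S : R :=
  if l is B :: l' then
    block_fun B A S +
    (if S :&: B == A :&: B then hard_fun l' (A :\: B) (S :\: B) / hard_bound
     else 0)
  else 0.

Lemma hard_bound_gt0 : 0 < hard_bound.
Proof.
rewrite /hard_bound ltr_wpDl// addr_ge0// mulr_ge0//.
Qed.

Lemma excess_on_le_dist B A S : `|excess_on B A S| <= dist_on B A S.
Proof.
have h1 : (#|S :&: B :&: A|%:R <= #|S :&: B|%:R :> R).
  by rewrite ler_nat subset_leq_card// subsetIl.
have h2 : (#|S :&: B :&: A|%:R <= #|A :&: B|%:R :> R).
  rewrite ler_nat subset_leq_card//; apply/fintype.subsetP => x.
  by rewrite !inE => /andP[/andP[_ ->] ->].
rewrite /excess_on /dist_on ler_norml; apply/andP; split; lra.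
Qed.

Lemma dist_on_le B A S : dist_on B A S <= #|V|%:R.
Proof.
have h : (#|S :&: B| + #|A :&: B| <= #|V| + #|S :&: B :&: A|)%N.
  have -> : S :&: B :&: A = (S :&: B) :&: (A :&: B).
    by apply/setP => x; rewrite !inE; case: (x \in B); rewrite ?andbF ?andbT.
  by rewrite -cardsUI leq_add2r max_card.
have h2 : (#|S :&: B| + #|A :&: B| <= #|V| + #|S :&: B :&: A| *2)%N by lia.
rewrite /dist_on; move: h2; rewrite -(ler_nat R) !natrD natrM; lra.
Qed.

Lemma dist_on_ge1 B A S : S :&: B != A :&: B -> 1 <= dist_on B A S.
Proof.
move=> ne.
have s1 : S :&: B :&: A \subset S :&: B by rewrite subsetIl.
have s2 : S :&: B :&: A \subset A :&: B.
  by rewrite -finset.setIA (finset.setIC B) finset.subsetIr.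
have h : (#|S :&: B :&: A| * 2 + 1 <= #|S :&: B| + #|A :&: B|)%N.
  have := subset_leq_card s1; have := subset_leq_card s2.
  rewrite leqNgt => h2 h1; rewrite leqNgt; apply/negP => h.
  have e1 : S :&: B :&: A == S :&: B by rewrite eqEcard s1; lia.
  have e2 : S :&: B :&: A == A :&: B by rewrite eqEcard s2; lia.
  by move: ne; rewrite -(eqP e1) {1}(eqP e2) eqxx.
rewrite /dist_on; move: h; rewrite -(ler_nat R) !natrD natrM; lra.
Qed.

Lemma block_fun_norm_le B A S : `|block_fun B A S| <= hard_bound - 1.
Proof.
have t1 := dist_on_le B A S.
have := excess_on_le_dist B A S.
have u1 : #|S :\: B|%:R <= #|V|%:R :> R by rewrite ler_nat max_card.
have u0 : 0 <= #|S :\: B|%:R :> R by [].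
rewrite /block_fun /hard_bound.
move: u1 u0 t1; move: (dist_on _ _ _) (excess_on _ _ _) (#|V|%:R : R)  (#|_|%:R : R).
move=> t x n u u1 u0 t1 xt.
have xn : `|x| <= n by apply: le_trans xt t1.
have x2 : x ^+ 2 <= n ^+ 2.
  by rewrite -[x ^+ 2]real_normK ?num_real// lerXn2r ?nnegrE //; lra.
have xu : `|x * u| <= n ^+ 2.
  by rewrite normrM expr2 ler_pM// ger0_norm.
move: xu; rewrite ler_norml => /andP[xu1 xu2].
have t0 : 0 <= t by apply: le_trans xt.
have tn : (6 * n + 3) * t <= (6 * n + 3) * n by apply: ler_wpM2l; lra.
have tn0 : 0 <= (6 * n + 3) * t by apply: mulr_ge0; lra.
have x20 := sqr_ge0 x.
rewrite ler_norml; apply/andP; split; nra.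
Qed.

Lemma hard_fun_norm_le l A S : `|hard_fun l A S| <= hard_bound.
Proof.
have K0 := hard_bound_gt0.
elim: l A S => [|B l IH] A S /=; first by rewrite normr0 ltW.
have hb := block_fun_norm_le B A S.
apply: le_trans (ler_normD _ _) _; rewrite -[leRHS](subrK 1) lerD//.
case: ifP => _; last by rewrite normr0.
by rewrite normrM normfV (gtr0_norm K0) ler_pdivrMr// mul1r.
Qed.

(** Modular terms cancel, and A with them: only [- 2 * p ^ 2 - 4 * p * u] contributes, where p and u
    count the elements inside and outside B. *)
Lemma block_fun_defect B A X Y :
  block_fun B A X + block_fun B A Y
  - block_fun B A (X :|: Y) - block_fun B A (X :&: Y) =
  4 * (#|(X :\: Y) :&: B| * #|(Y :\: X) :&: B|
     + #|(X :\: Y) :&: B| * #|Y :\: X :\: B|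
     + #|(Y :\: X) :&: B| * #|X :\: Y :\: B|)%N%:R.
Proof.
have split4 D : [/\ #|X :&: D|%:R = #|X :&: Y :&: D|%:R + #|(X :\: Y) :&: D|%:R :> R,
   #|Y :&: D|%:R = #|X :&: Y :&: D|%:R + #|(Y :\: X) :&: D|%:R :> R &
   #|(X :|: Y) :&: D|%:R = #|X :&: Y :&: D|%:R + #|(X :\: Y) :&: D|%:R
      + #|(Y :\: X) :&: D|%:R :> R].
  have h1 : (#|X :&: D| = #|X :&: Y :&: D| + #|(X :\: Y) :&: D|)%N.
    by rewrite -(cardsID Y) finset.setIAC (finset.setIDAC _ _ D).
  have h2 : (#|Y :&: D| = #|X :&: Y :&: D| + #|(Y :\: X) :&: D|)%N.
    rewrite -(cardsID X) finset.setIAC (finset.setIC Y X).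
    by rewrite (finset.setIDAC _ _ D).
  have h3 : (#|(X :|: Y) :&: D| + #|X :&: Y :&: D| = #|X :&: D| + #|Y :&: D|)%N.
    by rewrite -(cardsUI (X :&: D)) finset.setIUl finset.setIACA finset.setIid.
  by split; rewrite -?natrD; congr _%:R; lia.
have [b1 b2 b3] := split4 B.
have [c1 c2 c3] := split4 (~: B).
have [a1 a2 a3] := split4 (B :&: A).
rewrite /block_fun /dist_on /excess_on -![_ :&: B :&: A]finset.setIA.
rewrite -!finset.setDE in c1 c2 c3.
rewrite a1 a2 a3 b1 b2 b3 c1 c2 c3 !natrD !natrM.
ring.
Qed.

Lemma hard_fun_submodular l A : submodular (hard_fun l A).
Proof.
have K0 := hard_bound_gt0.
elim: l A => [|B l IH] A X Y /=; first by rewrite addr0.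
have [XY|nXY] := boolP (X \subset Y).
  by rewrite (finset.setUidPr XY) (finset.setIidPl XY) addrC.
have [YX|nYX] := boolP (Y \subset X).
  by rewrite (finset.setUidPl YX) (finset.setIidPr YX).
have defect := block_fun_defect B A X Y.
pose e S : R := if S :&: B == A :&: B
  then hard_fun l (A :\: B) (S :\: B) / hard_bound else 0.
rewrite -!/(e _).
have e1 S : `|e S| <= 1.
  rewrite /e; case: ifP => _; last by rewrite normr0.
  by rewrite normrM normfV (gtr0_norm K0) ler_pdivrMr// mul1r hard_fun_norm_le.
have cX : (#|X :\: Y| = #|(X :\: Y) :&: B| + #|X :\: Y :\: B|)%N.
  by rewrite cardsID.
have cY : (#|Y :\: X| = #|(Y :\: X) :&: B| + #|Y :\: X :\: B|)%N.
  by rewrite cardsID.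
have pX : (0 < #|X :\: Y|)%N by rewrite card_gt0 finset.setD_eq0.
have pY : (0 < #|Y :\: X|)%N by rewrite card_gt0 finset.setD_eq0.
(* With equal traces on B all four perturbations take the same branch, so the induction hypothesis
   applies. *)
have [XYB|nXYB] := eqVneq (X :&: B) (Y :&: B).
  have UB : (X :|: Y) :&: B = X :&: B by rewrite finset.setIUl XYB finset.setUid.
  have IB : (X :&: Y) :&: B = X :&: B.
    by rewrite -{1}(finset.setIid B) finset.setIACA XYB finset.setIid.
  suff : e (X :|: Y) + e (X :&: Y) <= e X + e Y.
    by move: defect; have := ler0n R (#|(X :\: Y) :&: B| * #|(Y :\: X) :&: B|
     + #|(X :\: Y) :&: B| * #|Y :\: X :\: B|
     + #|(Y :\: X) :&: B| * #|X :\: Y :\: B|)%N; lra.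
  rewrite /e UB IB -XYB; case: ifP => _; last by rewrite addr0.
  rewrite -!mulrDl ler_pM2r ?invr_gt0// finset.setDUl finset.setDIl.
  exact: IH.
(* Distinct traces make one factor inside B positive, and incomparability makes its cofactor
   positive. *)
have defect4 : 4 <= block_fun B A X + block_fun B A Y
    - block_fun B A (X :|: Y) - block_fun B A (X :&: Y).
  rewrite defect -[leLHS]mulr1 ler_pM2l// ler1n.
  have : (0 < #|(X :\: Y) :&: B| + #|(Y :\: X) :&: B|)%N.
    rewrite lt0n; apply: contra nXYB.
    rewrite addn_eq0 !finset.cards_eq0 !finset.setIDAC !finset.setD_eq0.
    by move=> /andP[s1 s2]; rewrite finset.eqEsubset !finset.subsetI s1 s2
      !finset.subsetIr.
  nia.
move: (e1 X) (e1 Y) (e1 (X :|: Y)) (e1 (X :&: Y)).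
by rewrite !ler_norml => /andP[? ?] /andP[? ?] /andP[? ?] /andP[? ?]; lra.
Qed.

Lemma setI_eq_setD {A S B B'} : S :&: B = A :&: B ->
  (S :\: B) :&: B' = (A :\: B) :&: B' -> S :&: B' = A :&: B'.
Proof.
move=> SA h; apply/setP => x; move/setP/(_ x) : h; move/setP/(_ x) : SA.
by rewrite !inE; case: (x \in B); rewrite ?andbT ?andbF // => ->.
Qed.

Lemma hard_fun_lt l A S : has (fun B => S :&: B != A :&: B) l ->
  hard_fun l A A < hard_fun l A S.
Proof.
have K0 := hard_bound_gt0.
elim: l A S => //= B l IH A S.
have A0 : block_fun B A A = 0.
  have -> : block_fun B A A = 
     (6 * #|V|%:R + 3) * (2 * (#|A :&: B|%:R - #|A :&: B :&: A|%:R)).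
    rewrite /block_fun /dist_on /excess_on; ring.
  by rewrite (finset.setIidPl (finset.subsetIl _ _)) subrr !mulr0.
rewrite A0 eqxx add0r.
have [SA|nSA] /= := eqVneq (S :&: B) (A :&: B); last first.
  move=> _; rewrite addr0.
  have h1 : hard_fun l (A :\: B) (A :\: B) / hard_bound <= 1.
    rewrite ler_pdivrMr// mul1r.
    by have := hard_fun_norm_le l (A :\: B) (A :\: B); rewrite ler_norml => /andP[].
  apply: le_lt_trans h1 _.
  have t1 := dist_on_ge1 _ _ _ nSA.
  have := excess_on_le_dist B A S.
  have tn := dist_on_le B A S.
  have u1 : #|S :\: B|%:R <= #|V|%:R :> R by rewrite ler_nat max_card.
  have u0 : 0 <= #|S :\: B|%:R :> R by [].
  rewrite /block_fun.
  move: u1 u0 t1 tn; move: (dist_on _ _ _) (excess_on _ _ _) (#|V|%:R : R) (#|_|%:R : R).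
  move=> t x n u u1 u0 t1 tn; rewrite ler_norml => /andP[x1 x2].
  (* These bounds leave a block term of at least [3 * t >= 3], while the value at A is at most 1. *)
  have xx : x ^+ 2 <= n * t by nra.
  have xu : x * u <= n * t by nra.
  nra.
move=> h; rewrite (_ : block_fun B A S = 0); last first.
  have -> : block_fun B A S = (6 * #|V|%:R + 3) * (#|S :&: B|%:R + #|A :&: B|%:R
     - 2 * #|S :&: B :&: A|%:R) - 2 * (#|S :&: B|%:R - #|A :&: B|%:R) ^+ 2
     - 4 * (#|S :&: B|%:R - #|A :&: B|%:R) * #|S :\: B|%:R by [].
  rewrite SA (finset.setIidPl (finset.subsetIl _ _)); ring.
rewrite add0r ltr_pM2r ?invr_gt0//; apply: IH.
apply: sub_has h => B'; apply: contra => /eqP h.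
exact/eqP/(setI_eq_setD SA h).
Qed.

Lemma minimizer_hard_fun l A S : minimizer (hard_fun l A) S ->
  all (fun B => S :&: B == A :&: B) l.
Proof.
move=> minS; rewrite -[all _ _]negbK -has_predC; apply/negP => /hard_fun_lt.
by rewrite ltNge minS.
Qed.

(** The recursion stops at the first disagreement, here among the first j blocks, so later blocks
    are never consulted. *)
Lemma hard_fun_take l j A S :
  has (fun B => S :&: B != A :&: B) (take j l) ->
  hard_fun l A S = hard_fun (take j l) A S.
Proof.
elim: l j A S => [|B l IH] [|j] A S //=.
have [SA|nSA] //= := eqVneq (S :&: B) (A :&: B).
move=> h; congr (_ + _ / _); apply: IH.
apply: sub_has h => B'; apply: contra => /eqP h.
exact/eqP/(setI_eq_setD SA h).
Qed.

Lemma eq_hard_fun l A A' : {in l, forall B, A :&: B = A' :&: B} ->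
  hard_fun l A = hard_fun l A'.
Proof.
elim: l A A' => [//|B l IH] A A' eqA.
have eqB : A :&: B = A' :&: B by apply: eqA; rewrite mem_head.
apply/funext => S /=.
rewrite /block_fun /dist_on /excess_on -!finset.setIA !(finset.setIC B) eqB.
rewrite (IH (A :\: B) (A' :\: B))// => B' lB'.
by rewrite !finset.setIDAC eqA// inE lB' orbT.
Qed.

End HardFunction.

(** * Counting the hidden sets that a deterministic algorithm can find *)

Section Deterministic.
Context {R : realType} {V : finType}.
Implicit Types (B A S X Y : {set V}) (l : seq {set V}).

(** An output is a guess just like a query, so both are counted together. *)
Definition exposed (x : action V) : seq {set V} :=
  match x with Query q => q | Output X => [:: X] end.

Definition hits l A (h : seq {set V}) : bool :=
  has (fun S => all (fun B => S :&: B == A :&: B) l) h.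

(* As long as round i never agrees with A on all of the first i + 1 blocks, the
   oracle may be replaced by one that does not know the blocks from j on. *)
Lemma transcript_hard_fun_take (a : algorithm R V) l A j :
  (forall i, (i < j)%N ->
     ~~ hits (take i.+1 l) A (exposed (a (transcript a (hard_fun l A) i)))) ->
  transcript a (hard_fun l A) j = transcript a (hard_fun (take j l) A) j.
Proof.
move=> miss.
suff: forall i, (i <= j)%N ->
    transcript a (hard_fun l A) i = transcript a (hard_fun (take j l) A) i.
  by apply.
elim=> [//|i IH] ij /=.
have := miss i ij; rewrite -IH ?(ltnW ij)//.
case: (a _) => [q|//] /= nh; congr rcons; rewrite /answers.
apply/eq_in_map => X qX; congr pair; apply: hard_fun_take.
have : has (fun B => X :&: B != A :&: B) (take i.+1 l).
  by rewrite has_predC; apply: contra nh => allX; apply/hasP; exists X.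
by rewrite -(minn_idPl ij) take_min => /hasP[B /mem_take lB neB]; apply/hasP; exists B.
Qed.

(** A minimizing output agrees with A on every block, so some round hits; up to the first such round
    the truncated oracle yields the same transcript. *)
Lemma minimizes_hits (a : algorithm R V) l A (r : R) :
  r <= (size l)%:R -> minimizes_in_fewer_than a (hard_fun l A) r ->
  exists2 j, (j < size l)%N &
    hits (take j.+1 l) A (exposed (a (transcript a (hard_fun (take j l) A) j))).
Proof.
move=> rl [k [S [kr]]]; rewrite /output_within.
case E : (a _) => [//|X] [<-] /minimizer_hard_fun minX.
pose p i := hits (take i.+1 l) A (exposed (a (transcript a (hard_fun l A) i))).
have pk : p k.
  rewrite /p E /hits /= orbF; apply/allP => B /mem_take; exact: (allP minX).
have exp : exists i, p i by exists k.
case: (ex_minnP exp) => j pj jmin.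
exists j.
  by rewrite -(ltr_nat R); apply: le_lt_trans (lt_le_trans kr rl); rewrite ler_nat jmin.
rewrite -transcript_hard_fun_take// => i ij.
by apply: contraL ij => /jmin; rewrite leqNgt.
Qed.

Lemma card_hit_block (L : {set V} -> seq {set V}) B (N : nat) :
  (forall A, size (L A) <= N)%N ->
  (#|[set A | has (fun S => S :&: B == A :&: B) (L (A :\: B))]|
     <= N * 2 ^ (#|V| - #|B|))%N.
Proof.
move=> LN.
(* Decoding map: a counted A is recovered from [A :\: B] and the index of a listed set that agrees
   with A on B. *)
pose g (u : {set V} * 'I_N) := u.1 :|: (nth finset.set0 (L u.1) u.2 :&: B).
apply: (@leq_trans #|[set g u | u in finset.setX (powerset (~: B)) [set: 'I_N]]|).
  apply: subset_leq_card; apply/fintype.subsetP => A; rewrite inE.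
  move=> /hasP[S LS /eqP SA].
  have iN : (index S (L (A :\: B)) < N)%N.
    by apply: leq_trans (LN (A :\: B)); rewrite index_mem.
  apply/imsetP; exists (A :\: B, Ordinal iN).
    by rewrite finset.in_setX powersetE !inE andbT finset.setDE finset.subsetIr.
  by rewrite /g /= nth_index// SA finset.setUC finset.setID.
apply: leq_trans (leq_imset_card _ _) _.
by rewrite cardsX card_powerset cardsT card_ord mulnC cardsCs finset.setCK.
Qed.

Lemma exists_blocks b m (U : {set V}) : (m * b <= #|U|)%N ->
  exists l, [/\ size l = m, {in l, forall B, #|B| = b /\ B \subset U} &
    pairwise (fun B B' => [disjoint B & B']) l].
Proof.
elim: m U => [|m IH] U; first by exists [::].
rewrite mulSn => mU.
pose B := [set x in take b (enum U)].
have BU : B \subset U.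
  by apply/fintype.subsetP => x; rewrite inE => /mem_take; rewrite mem_enum.
have cB : #|B| = b.
  rewrite cardsE; have /card_uniqP -> : uniq (take b (enum U)).
    by rewrite take_uniq ?enum_uniq.
  by rewrite size_takel// -cardE; lia.
have cUB : (m * b <= #|U :\: B|)%N.
  by rewrite cardsD (finset.setIidPr BU) cB; lia.
have [l [sl lP pl]] := IH _ cUB.
exists (B :: l); split=> /=; first by rewrite sl.
  move=> B'; rewrite inE => /orP[/eqP -> //|/lP[? sB']]; split=> //.
  by apply: fintype.subset_trans sB' (finset.subsetDl _ _).
rewrite pl andbT; apply/allP => B' /lP[_]; rewrite finset.subsetD disjoint_sym.
by move=> /andP[].
Qed.

Lemma card_minimizes (a : algorithm R V) l (b : nat) (N : nat) (r : R) :
  (0 < N)%N -> queries_per_round_le a N%:R ->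
  {in l, forall B, #|B| = b} -> pairwise (fun B B' => [disjoint B & B']) l ->
  r <= (size l)%:R ->
  (#|[set A | `[< minimizes_in_fewer_than a (hard_fun l A) r >]]|
    <= size l * (N * 2 ^ (#|V| - b)))%N.
Proof.
move=> N0 aN cardl disl rl.
pose L (j : nat) A := exposed (a (transcript a (hard_fun (take j l) A) j)).
have LN j A : (size (L j A) <= N)%N.
  rewrite /L; case E : (a _) => [q|//] /=.
  by rewrite -(ler_nat R); apply: aN E; exact: hard_fun_submodular.
pose bad (j : 'I_(size l)) := let B := nth finset.set0 l j in
  [set A | has (fun S => S :&: B == A :&: B) (L j (A :\: B))].
apply: (@leq_trans #|\bigcup_j bad j|).
  apply: subset_leq_card; apply/fintype.subsetP => A; rewrite inE => /asboolP.
  move=> /minimizes_hits[//|j jl]; rewrite -/(L j A) => hit.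
  apply/finset.bigcupP; exists (Ordinal jl) => //; rewrite inE /=.
  set B := nth _ _ _.
  (* The earlier blocks are disjoint from B, so the truncated oracle, and hence the list, does not
     depend on A inside B. *)
  have -> : L j (A :\: B) = L j A.
    rewrite /L (@eq_hard_fun _ _ _ (A :\: B) A)// => B' lB'.
    rewrite finset.setIDAC; apply/finset.setDidPl.
    apply: disjointWl (finset.subsetIr _ _) _.
    move: lB'; rewrite -index_mem; set i := index _ _.
    rewrite size_takel ?(ltnW jl)// => ij.
    have -> : B' = nth finset.set0 l i.
      by rewrite -(nth_take _ ij) nth_index// -index_mem size_takel ?(ltnW jl).
    by have /(pairwiseP finset.set0) := disl; apply; rewrite ?inE// (ltn_trans ij).
  apply: sub_has hit => S /allP; apply.
  by rewrite (take_nth finset.set0)// mem_rcons mem_head.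
apply: (@leq_trans (\sum_j #|bad j|)).
  elim/big_ind2: _ => [|U c U' c' h h'|//]; first by rewrite cards0.
  exact: leq_trans (leq_card_setU _ _) (leq_add h h').
rewrite -[X in (_ <= X * _)%N]card_ord -sum_nat_const; apply: leq_sum => j _.
have <- : #|nth finset.set0 l j| = b by apply: cardl; rewrite mem_nth.
exact: card_hit_block.
Qed.

End Deterministic.

(** * Measurability and averaging over the hidden set *)

Section Randomized.
Context {R : realType} {V : finType} {d : measure_display} {T : measurableType d}.
Local Open Scope classical_set_scope.

(** For a fixed oracle the queries determine the history, so only countably many histories occur
    although answers are real. *)
Lemma transcript_answers (a : algorithm R V) (f : {set V} -> R) k :
  exists qs : seq (seq {set V}), transcript a f k = [seq answers f q | q <- qs].
Proof.
elim: k => [|k [qs IH]] /=; first by exists [::].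
case: (a _) => [q|_]; last by exists qs.
by exists (rcons qs q); rewrite map_rcons IH.
Qed.

Lemma measurable_action_after (ALG : T -> algorithm R V) (f : {set V} -> R) k
    (E : history R V -> set (action V)) :
  randomized ALG ->
  measurable [set w | E (transcript (ALG w) f k) (ALG w (transcript (ALG w) f k))].
Proof.
move=> mALG; elim: k E => [|k IH] E; first exact: (mALG [::] (E [::])).
rewrite (_ : [set w | _] = \bigcup_(qs : seq (seq {set V}))
  ([set w | transcript (ALG w) f k.+1 = [seq answers f q | q <- qs]] `&`
   [set w | E [seq answers f q | q <- qs] (ALG w [seq answers f q | q <- qs])])).
  apply: countable_bigcupT_measurable => [|qs]; first exact: countableP.
  apply: measurableI; last exact: (mALG _ (E _)).
  exact: (IH (fun h x => match x with Query q => rcons h (answers f q)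
                         | Output _ => h end = [seq answers f q | q <- qs])).
apply/seteqP; split=> [w Ew|w [qs _ [/= <- //]]].
by have [qs e] := transcript_answers (ALG w) f k.+1; exists qs => //; rewrite /= -e.
Qed.

Lemma measurable_minimizes (ALG : T -> algorithm R V) (f : {set V} -> R) r :
  randomized ALG -> measurable [set w | minimizes_in_fewer_than (ALG w) f r].
Proof.
move=> mALG; rewrite (_ : [set w | _] = \bigcup_k
  [set w | exists S, [/\ k%:R < r,
    ALG w (transcript (ALG w) f k) = Output S & minimizer f S]]).
  apply: bigcupT_measurable => k.
  exact: (measurable_action_after _ _ k (fun _ x => exists S,
    [/\ k%:R < r, x = Output S & minimizer f S])).
apply/seteqP; split=> [w [k [S [kr]]]|w [k _ [S [kr e mS]]]].
  rewrite /output_within; case e : (ALG w _) => [//|X] [<-] mX.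
  by exists k => //; exists X.
by exists k, S; split=> //; rewrite /output_within e.
Qed.

(** Each point lies in at most c events, so their probabilities sum to at most c and one is at most
    the average. *)
Lemma exists_measure_le_average (P : probability T R) (I : finType) (E : I -> set T)
    (c : nat) : (0 < #|I|)%N -> (forall i, measurable (E i)) ->
  (forall w, #|[set i | `[< E i w >]]%SET| <= c)%N ->
  exists i, (P (E i) <= (c%:R / #|I|%:R)%:E)%E.
Proof.
move=> I0 mE cE; have I0' : 0 < #|I|%:R :> R by rewrite ltr0n.
have sum_le : (\sum_(i in I) P (E i) <= c%:R%:E)%E.
  have <- : (\int[P]_(w in setT) (c%:R : R)%:E = c%:R%:E)%E.
    by rewrite integral_cst//= probability_setT mule1.
  rewrite (eq_bigr (fun i => \int[P]_(w in setT) (\1_(E i) w)%:E)%E); last first.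
    by move=> i _; rewrite integral_indic// setIT.
  have mind i : measurable_fun [set: T] (EFin \o (\1_(E i) : T -> R)).
    by apply/measurable_EFinP; exact: measurable_indic.
  rewrite -big_enum -ge0_integral_sum//=.
  apply: ge0_le_integral => //=.
  - by move=> w _; apply: sume_ge0 => i _; rewrite lee_fin.
  - exact: emeasurable_sum mind.
  - move=> w _; rewrite big_enum /=.
    rewrite (eq_bigr (fun i => (i \in [set i | `[< E i w >]]%SET)%:R%:E)).
      rewrite sumEFin lee_fin -natr_sum ler_nat; apply: leq_trans (cE w).
      by rewrite -sum1_card [leqRHS]big_mkcond.
    by move=> i _; rewrite indicE !inE.
apply: contrapT => /forallNP h; move: sum_le; apply/negP; rewrite -ltNge.
have fP i : P (E i) = (fine (P (E i)))%:E by rewrite fineK// fin_num_measure.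
under eq_bigr do rewrite fP; rewrite sumEFin lte_fin.
rewrite [ltLHS](_ : _ = \sum_(i in I) (c%:R / #|I|%:R)).
  apply: ltr_sum => [|i _]; last first.
    by have := h i; rewrite fP lee_fin => /negP; rewrite -ltNge.
  by case/card_gt0P: I0 => i iI; apply/hasP; exists i; rewrite ?mem_index_enum.
by rewrite sumr_const -[RHS]mulr_natr divfK// gt_eqF.
Qed.

End Randomized.

(** * Choice of parameters and the error term *)

Section Asymptotics.
Context {R : realType}.
Local Open Scope classical_set_scope.

Definition rate (C : R) (n : nat) : R := 2 * C * log2 n%:R.

(** The condition on the rate bounds the rounding loss in the block size; where it fails, the value
    1 makes the claim trivial. *)
Definition failure (C : R) (n : nat) : R :=
  if (2 <= n)%N && (rate C n ^+ 2 <= n%:R) then 4 / n%:R else 1.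

Lemma ln2_gt0 : 0 < ln 2 :> R.
Proof. by rewrite ln_gt0// ltr1n. Qed.

Lemma sqr_rate_le (C : R) : 0 <= C -> \forall n \near \oo, rate C n ^+ 2 <= n%:R.
Proof.
move=> C0; pose K := 8 * C / ln 2.
have K0 : 0 <= K by apply: divr_ge0; [exact: mulr_ge0|exact/ltW/ln2_gt0].
near=> n.
have n0 : 0 < n%:R :> R.
  by apply: lt_le_trans (_ : 1 <= _); rewrite ?ler1n//; near: n; exact: nbhs_infty_gt.
(* With t the fourth root of n, [ln n <= 4 * t] makes the rate at most [K * t], and eventually
   [K <= t]. *)
set t := (n%:R : R) `^ 4^-1.
have t0 : 0 < t by rewrite powR_gt0.
have t4 : t ^+ 4 = n%:R.
  by rewrite -powR_mulrn ?ltW// -powRrM mulVf// powRr1 ?ltW.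
have lnt : ln (n%:R : R) <= 4 * t.
  by rewrite -t4 lnXn// -[leLHS]mulr_natl ler_pM2l// ltW// ln_sublinear.
have ln0 : 0 <= ln (n%:R : R).
  by rewrite ln_ge0// ler1n; near: n; exact: nbhs_infty_gt.
have Kt : K ^+ 2 <= t ^+ 2.
  rewrite -(@ler_pXn2r _ 2)// ?nnegrE ?sqr_ge0// -!exprM t4.
  by near: n; apply: nbhs_infty_ger.
have r0 : 0 <= rate C n.
  by apply: mulr_ge0; [exact: mulr_ge0|apply: divr_ge0 => //; exact/ltW/ln2_gt0].
have rK : rate C n <= K * t.
  rewrite /rate /log2 /K mulrA [leRHS]mulrAC ler_pM2r ?invr_gt0 ?ln2_gt0//.
  rewrite [8 * C](_ : _ = 2 * C * 4); last by ring.
  by rewrite -[leRHS]mulrA; apply: ler_wpM2l => //; apply: mulr_ge0.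
apply: (@le_trans _ _ ((K * t) ^+ 2)).
  by rewrite lerXn2r// nnegrE mulr_ge0// ltW.
by rewrite exprMn -t4 (_ : t ^+ 4 = t ^+ 2 * t ^+ 2) ?ler_pM2r ?exprn_gt0// -exprD.
Unshelve. all: by end_near. Qed.

Lemma cvg_failure (C : R) : 0 <= C -> failure C n @[n --> \oo] --> (0 : R).
Proof.
move=> C0; apply: (@cvg_trans _ ((4 / n%:R : R) @[n --> \oo])).
  apply: near_eq_cvg; near=> n; rewrite /failure ifT//; apply/andP; split.
    by near: n; exact: nbhs_infty_ge.
  by near: n; exact: sqr_rate_le.
rewrite -(mulr0 (4 : R)); apply: cvgMl_tmp.
rewrite -(cvg_shiftS (fun n => n%:R^-1 : R)); exact: cvg_harmonic.
Unshelve. all: by end_near. Qed.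

Lemma block_parameters (C : R) n : 2 <= C -> (2 <= n)%N -> rate C n ^+ 2 <= n%:R ->
  let m := (Num.truncn (n%:R / rate C n)).+1 in
  let N := Num.truncn (n%:R `^ C : R) in
  [/\ (0 < N)%N, n%:R / rate C n <= m%:R &
      (m * N)%:R / (2 ^ (n %/ m))%:R <= 4 / n%:R :> R].
Proof.
move=> C2 n2 rn m N.
have n1 : 1 <= n%:R :> R by rewrite ler1n ltnW.
have n0 : 0 < n%:R :> R by rewrite ltr0n ltnW.
have C0 : 0 <= C by apply: le_trans C2.
have n2' : 2 <= n%:R :> R by rewrite ler_nat.
have lnn : ln 2 <= ln (n%:R : R) by rewrite ler_ln ?posrE.
set y := rate C n; set x := n%:R / y.
have y4 : 4 <= y.
  rewrite /y /rate /log2 mulrA ler_pdivlMr ?ln2_gt0//.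
  by apply: ler_pM => //; [exact/ltW/ln2_gt0|lra].
have y0 : 0 < y by apply: lt_le_trans y4.
have xy : x * y = n%:R by rewrite /x divfK// gt_eqF.
have x0 : 0 <= x by rewrite /x divr_ge0// ltW.
have xm : x < m%:R by rewrite /m truncnS_gt.
have mx : m%:R <= x + 1.
  by rewrite /m -addn1 natrD lerD2r truncn_le.
have mn : m%:R <= n%:R :> R by nra.
have nC2 : n%:R ^+ 2 <= n%:R `^ C :> R.
  by rewrite -powR_mulrn ?(ltW n0)//; apply: ler_powR.
have nC1 : 1 <= n%:R `^ C :> R by apply: le_trans nC2; rewrite exprn_ege1.
have NC : N%:R <= n%:R `^ C :> R by rewrite truncn_le powR_ge0.
split; [by rewrite truncn_gt0|exact: ltW|].
set b := (n %/ m)%N.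
have nb : n%:R < m%:R * (b%:R + 1) :> R.
  by rewrite natr1 -natrM ltr_nat mulnC ltn_ceil.
(* Otherwise [n < (x + 1) * (y - 1)], which is less than [x * y = n] because [y <= x]. *)
have yb : y - 2 <= b%:R.
  have b0 : 0 <= b%:R :> R by [].
  rewrite leNgt; apply/negP => hb.
  have yx : y <= x by move: rn; rewrite -/y -xy expr2 ler_pM2r.
  nra.
(* By the choice of the rate, [2 ^ y = n ^ (2 * C)], and [y <= b + 2]. *)
have b4 : n%:R `^ C * n%:R `^ C <= 4 * (2 ^ b)%:R :> R.
  have yln : y * ln 2 = 2 * C * ln (n%:R : R).
    by rewrite /y /rate /log2 mulrA divfK// gt_eqF ?ln2_gt0.
  rewrite natrX (_ : 4 * 2 ^+ b = 2 ^+ (b + 2)); last first.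
    by rewrite exprD mulrC -(natrX _ 2 2).
  rewrite /powR gt_eqF// -expRD -{1}(@lnK R 2) ?posrE// -expRM_natl ler_expR.
  have := ln2_gt0; rewrite natrD; nra.
have bp : 0 < (2 ^ b)%:R :> R by rewrite ltr0n expn_gt0.
rewrite ler_pdivrMr// mulrAC ler_pdivlMr// natrM.
(* Here [m <= n] and [n ^ 2 <= n ^ C] absorb the factor [m * n]. *)
apply: le_trans b4; apply: le_trans (_ : n%:R ^+ 2 * (n%:R `^ C) <= _).
  by rewrite mulrAC expr2 ler_pM ?mulr_ge0// ler_pM2r.
by rewrite ler_pM2r// powR_gt0.
Qed.
End Asymptotics.

(** * The lower bound for randomized algorithms *)

Local Open Scope classical_set_scope.
Local Open Scope ring_scope.

(* eps C n is the o(1) term; the finitely many degenerate values of n (such as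
   n <= 1, where log2 n is not positive) are absorbed by it. *)
Theorem theorem1p2 (R : realType) :
  exists eps : R -> nat -> R,
    (forall C : R, 2 <= C -> eps C n @[n --> \oo] --> (0 : R)) /\
    forall (V : finType) (n : nat) (C : R),
      #|V| = n -> 2 <= C ->
      forall (d : measure_display) (T : measurableType d)
        (P : probability T R) (ALG : T -> algorithm R V),
        randomized ALG ->
        (forall w : T, queries_per_round_le (ALG w) (n%:R `^ C)) ->
        exists F : {set V} -> R,
          submodular F /\
          ((1 - eps C n)%:E <=
             P [set w | ~ minimizes_in_fewer_than (ALG w) F
                            (n%:R / (2 * C * log2 n%:R))])%E.
Proof.
exists failure; split=> [C C2|V n C cV C2 d T P ALG mALG qALG].
  by apply: cvg_failure; apply: le_trans C2.
rewrite -/(rate C n) /failure; case: ifP => [/andP[n2 rn]|_]; last first.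
  by exists (fun=> 0); split=> [X Y|]; rewrite ?subrr.
have [] := block_parameters _ _ C2 n2 rn.
set m := (Num.truncn _).+1; set N := Num.truncn _; set b := (n %/ m)%N.
move=> N0 rm small.
have mb : (m * b <= #|[set: V]%SET|)%N by rewrite cardsT cV mulnC leq_trunc_div.
have [l [sl lP disl]] := exists_blocks _ _ _ mb.
pose E A := [set w | minimizes_in_fewer_than (ALG w) (hard_fun l A : _ -> R)
                       (n%:R / rate C n)].
have mE A : measurable (E A) by exact: measurable_minimizes.
have cE w : (#|[set A | `[< E A w >]]%SET| <= m * (N * 2 ^ (n - b)))%N.
  rewrite -sl -cV; apply: card_minimizes => //; last 1 first.
  - by rewrite sl.
  (* Batch sizes are integers, so the real bound may be rounded down to N. *)
  - move=> f sf k q aq; rewrite ler_nat truncn_ge_nat ?powR_ge0//.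
    exact: qALG sf _ _ aq.
  - by move=> B /lP[].
have V0 : (0 < #|{set V}|)%N by apply/card_gt0P; exists finset.set0.
have [A PA] := exists_measure_le_average P _ _ _ V0 mE cE.
exists (hard_fun l A); split; first exact: hard_fun_submodular.
rewrite (_ : [set w | _] = ~` E A)// probability_setC// EFinB leeB//.
apply: le_trans PA _; rewrite lee_fin; apply: le_trans small.
(* Splitting off [2 ^ (n - b)] turns the average into [m * N / 2 ^ b]. *)
have -> : #|{set V}| = (2 ^ (n - b) * 2 ^ b)%N.
  by rewrite -expnD subnK ?leq_div// -cV -cardsT -card_powerset powersetT cardsT.
rewrite mulnA mulnC [X in _ / X]natrM [X in X / _]natrM -mulf_div divff ?mul1r//.
Qed.
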